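(* Let $\mathbb{F}$ be a field, let $\mathbf{Vec}$ be the category of finite-dimensional $\mathbb{F}$-vector spaces, and let $F:(\mathbb{R},\leq)\to\mathbf{Vec}$ be a functor. Then $F$ is tame if and only if $F$ has finite type.
   Context: $(\mathbb{R},\leq)$ denotes the poset of real numbers viewed as a category. For an interval $I\subseteq\mathbb{R}$ (possibly empty, bounded or unbounded, with or without endpoints), the diagram $\chi_I:(\mathbb{R},\leq)\to\mathbf{Vec}$ is given by $\chi_I(a)=\mathbb{F}$ if $a\in I$ and $0$ otherwise, and $\chi_I(a\leq b)=\mathrm{Id}_{\mathbb{F}}$ if $a,b\in I$ and $0$ otherwise. A diagram $F$ has finite type if $F\cong\bigoplus_{k=1}^N\chi_{I_k}$ (natural isomorphism, objectwise direct sum) for some finite collection of intervals $I_1,\dots,I_N\subseteq\mathbb{R}$. $F$ is constant on an interval $I$ if $F(a\leq b)$ is an isomorphism for all $a\leq b$ in $I$. A number $a\in\mathbb{R}$ is a regular value of $F$ if there is an open interval $I\ni a$ such that $F$ is constant on $I$; otherwise $a$ is a critical value of $F$. $F$ is tame if it has finitely many critical values. *)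

(* Defs.v *)
From HB Require Import structures.
From mathcomp Require Import all_boot all_order all_algebra.
From mathcomp Require Import all_classical all_reals all_analysis.

Set Implicit Arguments.
Unset Strict Implicit.
Unset Printing Implicit Defensive.

Import Order.TTheory GRing.Theory Num.Theory.
Import numFieldNormedType.Exports.

Local Open Scope classical_set_scope.
Local Open Scope ring_scope.

(* Functors from the poset (R, <=) to finite-dimensional K-vector spaces. As
   `a <= b` is a boolean, its proof (the unique arrow from a to b) is irrelevant. *)
Record diagram (K : fieldType) (R : realType) := Diagram {
  dobj :> R -> vectType K;
  dmap : forall a b : R, a <= b -> 'Hom(dobj a, dobj b);
  dmap_id : forall (a : R) (aa : a <= a), dmap aa = \1%VF;
  dmap_comp : forall (a b c : R) (ab : a <= b) (bc : b <= c) (ac : a <= c),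
    dmap ac = (dmap bc \o dmap ab)%VF }.

Arguments dmap {K R} d {a b} ab.

Definition is_iso (K : fieldType) (V W : vectType K) (f : 'Hom(V, W)) : Prop :=
  exists g : 'Hom(W, V), (g \o f)%VF = \1%VF /\ (f \o g)%VF = \1%VF.

Definition diagram_iso (K : fieldType) (R : realType) (D E : diagram K R) : Prop :=
  exists phi : forall a : R, 'Hom(D a, E a),
    (forall a, is_iso (phi a)) /\
    (forall (a b : R) (ab : a <= b),
       (phi b \o dmap D ab)%VF = (dmap E ab \o phi a)%VF).

Section IntervalDiagram.
Variables (K : fieldType) (R : realType) (I : interval R).

Definition chi_space (inI : bool) : vectType K :=
  if inI then K^o : vectType K else 'rV[K]_0 : vectType K.

Definition chi_hom (aI bI : bool) : 'Hom(chi_space aI, chi_space bI) :=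
  match aI, bI return 'Hom(chi_space aI, chi_space bI) with
  | true, true => \1%VF
  | _, _ => 0
  end.

Definition chi_map (a b : R) (_ : a <= b) :
  'Hom(chi_space (a \in I), chi_space (b \in I)) := chi_hom (a \in I) (b \in I).

Lemma chi_map_id (a : R) (aa : a <= a) : chi_map aa = \1%VF.
Proof.
rewrite /chi_map; case: (a \in I) => //=.
by apply/lfunP => x; rewrite id_lfunE zero_lfunE [x]thinmx0.
Qed.

Lemma chi_map_comp (a b c : R) (ab : a <= b) (bc : b <= c) (ac : a <= c) :
  chi_map ac = (chi_map bc \o chi_map ab)%VF.
Proof.
rewrite /chi_map; have : a \in I -> c \in I -> b \in I.
  by move=> aI cI; apply: (@interval_is_interval R I a c) => //; rewrite ab bc.
case: (a \in I) (b \in I) (c \in I) => [] [] [] //= H;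
  rewrite ?(comp_lfun1l, comp_lfun0l, comp_lfun0r) //.
by have := H isT isT.
Qed.

Definition chi : diagram K R :=
  @Diagram K R (fun a => chi_space (a \in I)) chi_map chi_map_id chi_map_comp.

End IntervalDiagram.

Arguments chi K {R} I.

Section DirectSum.
Variables (K : fieldType) (R : realType).

Definition zero_diagram_map (a b : R) (_ : a <= b) : 'Hom('rV[K]_0, 'rV[K]_0) := 0.

Lemma zero_diagram_map_id (a : R) (aa : a <= a) : zero_diagram_map aa = \1%VF.
Proof. by apply/lfunP => x; rewrite id_lfunE zero_lfunE [x]thinmx0. Qed.

Lemma zero_diagram_map_comp (a b c : R) (ab : a <= b) (bc : b <= c) (ac : a <= c) :
  zero_diagram_map ac = (zero_diagram_map bc \o zero_diagram_map ab)%VF.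
Proof. by rewrite /zero_diagram_map comp_lfun0r. Qed.

Definition zero_diagram : diagram K R :=
  @Diagram K R (fun=> 'rV[K]_0 : vectType K) zero_diagram_map
    zero_diagram_map_id zero_diagram_map_comp.

Variables D E : diagram K R.

Definition dsum_map_fun (a b : R) (ab : a <= b) (u : (D a * E a)%type) :
  (D b * E b)%type := (dmap D ab u.1, dmap E ab u.2).

Lemma dsum_map_fun_is_linear (a b : R) (ab : a <= b) : linear (@dsum_map_fun a b ab).
Proof. by move=> k u v; rewrite /dsum_map_fun /= !linearP. Qed.

HB.instance Definition _ (a b : R) (ab : a <= b) :=
  GRing.isLinear.Build K (D a * E a)%type (D b * E b)%type _
    (@dsum_map_fun a b ab) (@dsum_map_fun_is_linear a b ab).

Definition dsum_map (a b : R) (ab : a <= b) :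
  'Hom((D a * E a)%type, (D b * E b)%type) := linfun (@dsum_map_fun a b ab).

Lemma dsum_map_id (a : R) (aa : a <= a) : dsum_map aa = \1%VF.
Proof.
apply/lfunP => -[x y].
by rewrite lfunE /= /dsum_map_fun !dmap_id !id_lfunE.
Qed.

Lemma dsum_map_comp (a b c : R) (ab : a <= b) (bc : b <= c) (ac : a <= c) :
  dsum_map ac = (dsum_map bc \o dsum_map ab)%VF.
Proof.
apply/lfunP => -[x y].
by rewrite comp_lfunE !lfunE /= /dsum_map_fun (dmap_comp D ab bc ac) (dmap_comp E ab bc ac) !comp_lfunE.
Qed.

(* Objectwise binary direct sum. *)
Definition dsum : diagram K R :=
  @Diagram K R (fun a => (D a * E a)%type : vectType K) dsum_map
    dsum_map_id dsum_map_comp.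

End DirectSum.

Definition finite_type (K : fieldType) (R : realType) (D : diagram K R) : Prop :=
  exists (N : nat) (I : 'I_N -> interval R),
    diagram_iso D (\big[@dsum K R/@zero_diagram K R]_(k < N) chi K (I k)).

Section Tame.
Variables (K : fieldType) (R : realType) (D : diagram K R).

Definition constant_on (I : interval R) : Prop :=
  forall (a b : R) (ab : a <= b), a \in I -> b \in I -> is_iso (dmap D ab).

Definition regular_value (a : R) : Prop :=
  exists I : interval R, [/\ open [set` I], a \in I & constant_on I].

Definition critical_value (a : R) : Prop := ~ regular_value a.

Definition tame : Prop := finite_set [set a : R | critical_value a].

End Tame.

(* Main.v *)
From HB Require Import structures.
Require Import Defs.
From mathcomp Require Import all_boot all_order all_algebra.
From mathcomp Require Import all_classical all_reals all_analysis.

Set Implicit Arguments.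
Unset Strict Implicit.
Unset Printing Implicit Defensive.

Import Order.TTheory GRing.Theory Num.Theory.
Import numFieldNormedType.Exports.

Local Open Scope classical_set_scope.
Local Open Scope ring_scope.

(** A diagram is tame exactly when it is a finite direct sum of intervals.

    Finite sums of intervals are tame because [chi I] can only be critical at an
    endpoint of [I], because a point that is regular for two diagrams is regular
    for their sum (intersect the two open intervals), and because regularity is
    invariant under isomorphism ([tame_chi], [tame_dsum], [tame_iso]).

    Conversely, let [D] be tame. An internal map of [D] over a segment without
    critical values is an isomorphism: the supremum of the points up to which
    this holds cannot lie strictly inside the segment, since [D] is constant
    around it ([constant_on_regular_segment]). The finitely many critical values
    cut the line into finitely many cells, each a point or an open interval, and
    [D] is constant on each of them. Choosing one sample point per cell gives a
    monotone map [f] with finite image such that [D] is isomorphic to its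
    pullback [D o f] ([tame_sampled]).

    It remains to decompose [D o f], by induction on the sum of the dimensions
    of [D] at the samples. If it is not zero, take the first sample [a] with
    [D a != 0], the last sample [b] such that [D a -> D b] is not zero, and a
    vector [v0] of [D a] with nonzero image in [D b]. By the choice of [b], the
    vector [v0] dies at every sample after [b], so it spans a copy of an interval
    diagram [chi I], where [I] is the set of points [x] with
    [a <= f x <= b]. A linear form [p0] on [D b] with value 1 on the image of
    [v0] is pulled back to every [D x] with [x <= b] and extended by zero after
    [b]. By the choice of [a], nothing lives before [a], so these forms make up
    a retraction of [D o f] onto that copy of [chi I]. The kernels of the forms
    are a complement, of smaller dimension at [a] ([split_off_bar]). *)

(** * Isomorphisms of vector spaces and of diagrams *)

Section Isomorphisms.
Variable K : fieldType.

Lemma is_isoP (V W : vectType K) (f : 'Hom(V, W)) :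
  is_iso f <-> (forall x, f x = 0 -> x = 0) /\ (forall y, exists x, f x = y).
Proof.
split=> [[g [gf fg]] | [f_inj f_surj]].
  split=> [x fx0 | y].
    by rewrite -[x](id_lfunE) -gf comp_lfunE fx0 linear0.
  by exists (g y); rewrite -comp_lfunE fg id_lfunE.
exists (f^-1)%VF; have ker0 : lker f == 0%VS.
  by apply/lker0P/raddf_inj => x /f_inj.
split; apply/lfunP => x; rewrite comp_lfunE id_lfunE.
  by rewrite lker0_lfunK.
by apply: limg_lfunVK; have [y <-] := f_surj x; apply: memv_img (memvf _).
Qed.

Lemma is_iso_id (V : vectType K) : is_iso (\1%VF : 'Hom(V, V)).
Proof. by exists \1%VF; rewrite comp_lfun1l. Qed.

Lemma is_iso_comp (U V W : vectType K) (g : 'Hom(V, W)) (f : 'Hom(U, V)) :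
  is_iso g -> is_iso f -> is_iso (g \o f)%VF.
Proof.
move=> /is_isoP[g_inj g_surj] /is_isoP[f_inj f_surj]; apply/is_isoP; split.
  by move=> x; rewrite comp_lfunE => /g_inj/f_inj.
by move=> z; have [y <-] := g_surj z; have [x <-] := f_surj y; exists x;
  rewrite comp_lfunE.
Qed.

Lemma is_iso_inv (V W : vectType K) (f : 'Hom(V, W)) :
  is_iso f -> is_iso (f^-1)%VF.
Proof.
move=> /is_isoP[f_inj f_surj].
have ker0 : lker f == 0%VS by apply/lker0P/raddf_inj => x /f_inj.
exists f; split; apply/lfunP => x; rewrite comp_lfunE id_lfunE.
  by apply: limg_lfunVK; have [y <-] := f_surj x; apply: memv_img (memvf _).
by rewrite lker0_lfunK.
Qed.

Lemma iso_lfunVK (V W : vectType K) (f : 'Hom(V, W)) :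
  is_iso f -> cancel (f^-1)%VF f.
Proof.
move=> /is_isoP[_ f_surj] x; apply: limg_lfunVK.
by have [y <-] := f_surj x; apply: memv_img (memvf _).
Qed.

Lemma iso_inj (V W : vectType K) (f : 'Hom(V, W)) : is_iso f -> injective f.
Proof. by move=> /is_isoP[f_inj _]; apply/raddf_inj => x /f_inj. Qed.

Lemma is_iso_zero_spaces (V W : vectType K) (f : 'Hom(V, W)) :
  (forall x : V, x = 0) -> (forall y : W, y = 0) -> is_iso f.
Proof.
by move=> V0 W0; apply/is_isoP; split=> [x _ // | y]; exists 0; rewrite linear0 (W0 y).
Qed.

Variable R : realType.

Lemma dmap_compE (D : diagram K R) (a b c : R) (ab : a <= b) (bc : b <= c)
    (ac : a <= c) (u : D a) : dmap D bc (dmap D ab u) = dmap D ac u.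
Proof. by rewrite (dmap_comp D ab bc ac) comp_lfunE. Qed.

Lemma dmap_idE (D : diagram K R) (a : R) (aa : a <= a) (u : D a) :
  dmap D aa u = u.
Proof. by rewrite dmap_id id_lfunE. Qed.

Lemma diagram_iso_trans (D E G : diagram K R) :
  diagram_iso D E -> diagram_iso E G -> diagram_iso D G.
Proof.
move=> [phi [phi_iso phi_nat]] [psi [psi_iso psi_nat]].
exists (fun a => (psi a \o phi a)%VF); split=> [a | a b ab].
  exact: is_iso_comp.
by rewrite -comp_lfunA phi_nat comp_lfunA psi_nat comp_lfunA.
Qed.

Lemma diagram_iso_sym (D E : diagram K R) : diagram_iso D E -> diagram_iso E D.
Proof.
move=> [phi [phi_iso phi_nat]].
exists (fun a => (phi a)^-1%VF); split=> [a | a b ab]; first exact: is_iso_inv.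
apply/lfunP => u; rewrite !comp_lfunE; apply: (iso_inj (phi_iso b)).
rewrite iso_lfunVK // -[RHS]comp_lfunE phi_nat comp_lfunE iso_lfunVK //.
Qed.

Lemma dsum_mapE (D E : diagram K R) (a b : R) (ab : a <= b) (u : dsum D E a) :
  dmap (dsum D E) ab u = (dmap D ab u.1, dmap E ab u.2).
Proof. by rewrite /= lfunE. Qed.

Lemma diagram_iso_dsumr (D E E' : diagram K R) :
  diagram_iso E E' -> diagram_iso (dsum D E) (dsum D E').
Proof.
move=> [phi [phi_iso phi_nat]].
pose psi_fun a (u : dsum D E a) : dsum D E' a := (u.1, phi a u.2).
have psi_lin a : linear (psi_fun a).
  by move=> k u v; rewrite /psi_fun /= linearP.
pose psiL a : {linear dsum D E a -> dsum D E' a} :=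
  HB.pack (psi_fun a) (GRing.isLinear.Build _ _ _ _ _ (psi_lin a)).
exists (fun a => linfun (psiL a)); split=> [a | a b ab].
  have /is_isoP[phi_inj phi_surj] := phi_iso a; apply/is_isoP; split.
    by move=> [x y]; rewrite lfunE /= => -[-> /phi_inj ->].
  move=> [x y]; have [z <-] := phi_surj y.
  by exists (x, z); rewrite lfunE.
apply/lfunP => u; rewrite !comp_lfunE !dsum_mapE !lfunE /psi_fun /=.
by congr pair; rewrite -!comp_lfunE phi_nat.
Qed.

End Isomorphisms.

(** * Finite type implies tame *)

Section FiniteTypeTame.
Variables (K : fieldType) (R : realType).
Implicit Types D E : diagram K R.

(** The maps of [D] are the conjugates of the maps of [E] by the isomorphism. *)
Lemma regular_iso D E (a : R) :
  diagram_iso D E -> regular_value E a -> regular_value D a.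
Proof.
move=> [phi [phi_iso phi_nat]] [I [Iopen aI Econst]].
exists I; split=> // x y xy xI yI.
have -> : dmap D xy = ((phi y)^-1 \o (dmap E xy \o phi x))%VF.
  apply/lfunP => u; apply: (iso_inj (phi_iso y)).
  by rewrite -phi_nat !comp_lfunE iso_lfunVK.
by do 2?apply: is_iso_comp; [exact: is_iso_inv | exact: Econst | exact: phi_iso].
Qed.

Lemma tame_iso D E : diagram_iso D E -> tame E -> tame D.
Proof.
move=> DE; apply: sub_finite_set => a Da Ea.
exact: Da (regular_iso DE Ea).
Qed.

Lemma open_itv_meet (I J : interval R) :
  open [set` I] -> open [set` J] -> open [set` (I `&` J)%O].
Proof.
move=> Iopen Jopen.
have -> : [set` (I `&` J)%O] = [set` I] `&` [set` J].
  by apply/seteqP; split=> x /=; rewrite in_itvI => /andP.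
exact: openI.
Qed.

Lemma regular_dsum D E (a : R) :
  regular_value D a -> regular_value E a -> regular_value (dsum D E) a.
Proof.
move=> [I [Iopen aI Dconst]] [J [Jopen aJ Econst]].
exists (I `&` J)%O; split=> [||x y xy].
- exact: open_itv_meet.
- by rewrite in_itvI aI.
rewrite !in_itvI => /andP[xI xJ] /andP[yI yJ].
have /is_isoP[Dinj Dsurj] := Dconst _ _ xy xI yI.
have /is_isoP[Einj Esurj] := Econst _ _ xy xJ yJ.
apply/is_isoP; split=> [[u v] | [u v]].
  by rewrite dsum_mapE => -[/Dinj -> /Einj ->].
have [u' <-] := Dsurj u; have [v' <-] := Esurj v.
by exists (u', v'); rewrite dsum_mapE.
Qed.

Lemma tame_dsum D E : tame D -> tame E -> tame (dsum D E).
Proof.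
move=> Dtame Etame; have : finite_set ([set a | critical_value D a] `|`
    [set a | critical_value E a]) by rewrite finite_setU.
apply: sub_finite_set => a /= DEa; apply: contrapT => /not_orP[].
move=> /contrapT Da /contrapT Ea; exact: DEa (regular_dsum Da Ea).
Qed.

Lemma tame_zero : tame (zero_diagram K R).
Proof.
rewrite /tame (_ : [set a | _] = set0) //.
apply/seteqP; split=> // a; apply; exists `]-oo, +oo[; split=> //.
by move=> x y xy _ _; apply: is_iso_zero_spaces => u; rewrite [u]thinmx0.
Qed.

Lemma chi_hom_iso (b : bool) : is_iso (chi_hom K b b).
Proof.
case: b; first exact: is_iso_id.
by apply: is_iso_zero_spaces => u; rewrite [u]thinmx0.
Qed.

Definition bound_points (b : itv_bound R) : set R :=
  if b is BSide _ x then [set x] else set0.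

(** Around a point that is not the bound itself, being on the inner side of a
    left bound does not change. Right bounds are covered as well, because
    [BRight x <= b] is the negation of [b <= BLeft x]. *)
Lemma bound_locally_constant (b : itv_bound R) (a : R) : ~ bound_points b a ->
  exists J : interval R, [/\ itv_open_ends J, a \in J &
    forall x, x \in J -> (b <= BLeft x)%O = (b <= BLeft a)%O].
Proof.
case: b => [s x /= /eqP ax | s _]; last first.
  by exists `]-oo, +oo[; split.
case: (ltgtP a x) ax => // ax _; [exists `]-oo, x[ | exists `]x, +oo[]; split;
  rewrite ?in_itv /= ?ax // => y; rewrite in_itv /= ?andbT => yx.
- by case: s; rewrite !bnd_simp ?(lt_geF yx) ?(lt_geF ax) ?(lt_gtF yx) ?(lt_gtF ax).
- by case: s; rewrite !bnd_simp ?yx ?ax ?(ltW yx) ?(ltW ax).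
Qed.

(** Away from the two endpoints, membership in the interval is locally constant,
    so the diagram stays either [K] or [0]. *)
Lemma tame_chi (I : interval R) : tame (chi K I).
Proof.
case: I => l u; have finE b : finite_set (bound_points b).
  by case: b => [s x | s]; [exact: finite_set1 | exact: finite_set0].
have : finite_set (bound_points l `|` bound_points u) by rewrite finite_setU.
apply: sub_finite_set => a /= a_crit; apply: contrapT => /not_orP[].
move=> /bound_locally_constant[J [Jopen aJ Jl]].
move=> /bound_locally_constant[J' [J'open aJ' J'u]]; apply: a_crit.
have chi_const x : x \in J -> x \in J' ->
    (x \in Interval l u) = (a \in Interval l u).
  by move=> xJ xJ'; rewrite !itv_boundlr !leBRight_ltBLeft !ltNge Jl // J'u.
exists (J `&` J')%O; split=> [||x y xy].
- by apply: open_itv_meet; exact: itv_open_ends_open.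
- by rewrite in_itvI aJ.
rewrite !in_itvI => /andP[xJ xJ'] /andP[yJ yJ'].
rewrite /= /chi_map !chi_const //; exact: chi_hom_iso.
Qed.

Lemma finite_type_tame D : finite_type D -> tame D.
Proof.
move=> [N [I DI]]; apply: tame_iso DI _; apply: big_ind => [|E E'|k _].
- exact: tame_zero.
- exact: tame_dsum.
- exact: tame_chi.
Qed.

End FiniteTypeTame.

(** * A tame diagram factors through finitely many points *)

Section Sampling.
Variables (K : fieldType) (R : realType).
Implicit Types D : diagram K R.

(** Local constancy propagates along a segment. The set [S] of points [x] with
    [D a -> D x] invertible contains [a]; around its supremum [s] the diagram is
    constant on some ball, which contains a point of [S]. Hence [S] contains
    every point of the segment in that ball: either [b] itself, or a point
    beyond [s], which is absurd. *)
Lemma constant_on_regular_segment D (a b : R) (ab : a <= b) :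
  (forall x, a <= x <= b -> regular_value D x) -> is_iso (dmap D ab).
Proof.
move=> Dreg.
pose S := [set x | x <= b /\ exists ax : a <= x, is_iso (dmap D ax)].
have aS : S a.
  by split=> //; exists (lexx a); rewrite dmap_id; exact: is_iso_id.
have S_ub : ubound S b by move=> x [].
have S_sup : has_sup S by split; [exists a | exists b].
pose s := sup S.
have a_s : a <= s by exact: ub_le_sup S_sup.2 _ aS.
have sb : s <= b by apply: ge_sup => //; exists a.
have [I [Iopen sI Dconst]] := Dreg s (introT andP (conj a_s sb)).
have /nbhs_ballP[e /= e0 eI] : nbhs s [set` I] by apply: open_nbhs_nbhs.
have [x [xb [ax Dax]] sx] := sup_adherent e0 S_sup.
have xs : x <= s by apply: (ub_le_sup S_sup.2); split; [|exists ax].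
have near_s y : s - e < y -> y < s + e -> y \in I.
  by move=> y1 y2; apply: (eI y); rewrite /ball /= ltr_distlC y1.
have xI : x \in I by apply: near_s => //; rewrite (le_lt_trans xs) // ltrDl.
have extend y (ay : a <= y) : x <= y -> y \in I -> is_iso (dmap D ay).
  move=> xy yI; rewrite (dmap_comp D ax xy ay).
  by apply: is_iso_comp => //; exact: Dconst.
have [bI | bNI] := boolP (b \in I); first exact: extend.
have {}bse : s + e <= b.
  rewrite leNgt; apply/negP => bse; case/negP: bNI; apply: near_s => //.
  by rewrite (lt_le_trans _ sb) // ltrBlDr ltrDl.
have sy : s < s + e / 2 by rewrite ltrDl divr_gt0.
have yse : s + e / 2 < s + e by rewrite ltrD2l gtr_pMr // invf_lt1 // ltr1n.
suff : S (s + e / 2).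
  by move=> /(ub_le_sup (proj2 S_sup)); rewrite leNgt sy.
split; first exact: le_trans (ltW yse) bse.
have ay : a <= s + e / 2 by rewrite (le_trans a_s) // ltW.
exists ay; apply: extend; first by rewrite (le_trans xs) // ltW.
by apply: near_s => //; rewrite (lt_trans _ sy) // ltrBlDr ltrDl.
Qed.

Section Pullback.
Variables (D : diagram K R) (f : R -> R) (f_mono : {homo f : x y / x <= y}).

Definition pullback_map (a b : R) (ab : a <= b) : 'Hom(D (f a), D (f b)) :=
  dmap D (f_mono ab).

Lemma pullback_map_id (a : R) (aa : a <= a) : pullback_map aa = \1%VF.
Proof. exact: dmap_id. Qed.

Lemma pullback_map_comp (a b c : R) (ab : a <= b) (bc : b <= c) (ac : a <= c) :
  pullback_map ac = (pullback_map bc \o pullback_map ab)%VF.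
Proof. exact: dmap_comp. Qed.

Definition pullback : diagram K R :=
  @Diagram K R (fun a => D (f a)) pullback_map pullback_map_id pullback_map_comp.

(** A point [a] and its sample [f a] may come in either order. Passing through
    their maximum avoids the distinction: the component at [a] goes up from [a]
    to the maximum and then back down to [f a]. *)
Lemma diagram_iso_pullback :
  (forall a (h : a <= Num.max a (f a)), is_iso (dmap D h)) ->
  (forall a (h : f a <= Num.max a (f a)), is_iso (dmap D h)) ->
  diagram_iso D pullback.
Proof.
move=> iso_l iso_r.
have maxl a : a <= Num.max a (f a) by rewrite le_max lexx.
have maxr a : f a <= Num.max a (f a) by rewrite le_max lexx orbT.
pose phi a : 'Hom(D a, pullback a) :=
  ((dmap D (maxr a))^-1 \o dmap D (maxl a))%VF.
have phiE a u : dmap D (maxr a) (phi a u) = dmap D (maxl a) u.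
  by rewrite comp_lfunE iso_lfunVK.
exists phi; split=> [a | a b ab].
  exact: is_iso_comp (is_iso_inv (iso_r a _)) (iso_l a _).
have ab_max : Num.max a (f a) <= Num.max b (f b).
  by rewrite ge_max (le_trans ab) // (le_trans (f_mono ab)).
have fa_max := le_trans (maxr a) ab_max.
have a_max := le_trans (maxl a) ab_max.
(* Compare both sides after mapping them into the space at max(b, f b). *)
apply/lfunP => u; rewrite comp_lfunE [RHS]comp_lfunE; apply: (iso_inj (iso_r b (maxr b))).
rewrite phiE dmap_compE /= /pullback_map dmap_compE.
by rewrite -(dmap_compE (maxr a) ab_max) phiE dmap_compE.
Qed.

End Pullback.

(** Two points lie in the same cell of the line cut at the critical values when
    they have the same strict and the same large comparison with every critical
    value; this pattern of comparisons, the [key] of a point, ranges over a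
    finite type. A segment between two distinct points with the same key
    contains no critical value. *)
Lemma tame_sampled D : tame D -> exists (T : finType) (s : T -> R)
    (f : R -> R) (f_mono : {homo f : x y / x <= y}),
  (forall x, exists t, f x = s t) /\ diagram_iso D (pullback D f_mono).
Proof.
move=> /finite_seqP[C critC].
have regC x : x \notin C -> regular_value D x.
  move=> xC; apply: contrapT => x_crit; case/negP: xC.
  by have : [set a | critical_value D a] x by []; rewrite critC.
pose side (x c : R) := (c < x, c <= x).
pose key (x : R) := map_tuple (side x) (in_tuple C).
have keyP x y : key x = key y <-> {in C, side x =1 side y}.
  split=> [/(congr1 val)/eq_in_map // | xy]; apply: val_inj; exact/eq_in_map.
have key_iso x y (xy : x <= y) : key x = key y -> is_iso (dmap D xy).
  move=> /keyP rxy; have [xy_eq | x_neq_y] := eqVneq x y.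
    by subst y; rewrite dmap_id; exact: is_iso_id.
  apply: constant_on_regular_segment => z /andP[xz zy]; apply: regC.
  apply/negP => /rxy[]; rewrite zy ltNge xz /= => zy_eq zx_eq.
  case/negP: x_neq_y; rewrite eq_le xy /=.
  by rewrite (le_trans _ zx_eq) // leNgt -zy_eq.
pose s k := xget 0 [set x | key x = k].
pose f x := s (key x).
have key_f x : key (f x) = key x.
  by apply: (@xgetPex _ 0 [set y | key y = key x]); exists x.
(* If f y < f x although x <= y, then each of key x, key y is dominated by the
   other, so they are equal and f x = f y. *)
have f_mono : {homo f : x y / x <= y}.
  move=> x y xy; rewrite leNgt; apply/negP => fyx.
  suff key_xy : key x = key y by move: fyx; rewrite /f key_xy ltxx.
  apply/keyP => c cC; have := (keyP _ _).1 (key_f x) c cC.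
  have := (keyP _ _).1 (key_f y) c cC => -[fy1 fy2] [fx1 fx2].
  congr pair; apply/idP/idP => [cx|];
    do 1?exact: lt_le_trans xy; do 1?exact: le_trans xy.
  - by rewrite -fy1 -fx1 => /lt_trans; apply.
  - by rewrite -fy2 -fx2 => /le_trans; apply; exact: ltW.
exists _, s, f, f_mono; split=> [x | ]; first by exists (key x).
by apply: diagram_iso_pullback => a; have [fa | af] := leP a (f a) => h;
  apply: key_iso; rewrite ?key_f.
Qed.

End Sampling.

(** * Splitting off one interval *)

Section Splitting.
Variables (K : fieldType) (R : realType).
Implicit Types D E : diagram K R.

Lemma finite_type_iso D E : diagram_iso D E -> finite_type E -> finite_type D.
Proof. by move=> DE [N [I EI]]; exists N, I; exact: diagram_iso_trans EI. Qed.

Lemma finite_type_dsum_chi (I : interval R) E :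
  finite_type E -> finite_type (dsum (chi K I) E).
Proof.
move=> [N [J EJ]].
exists N.+1, (fun k => if unlift ord0 k is Some i then J i else I).
rewrite big_ord_recl unlift_none; under eq_bigr do rewrite liftK.
exact: diagram_iso_dsumr.
Qed.

Lemma finite_type_zero D : (forall a (u : D a), u = 0) -> finite_type D.
Proof.
move=> D0; exists 0%N, (fun=> `]-oo, +oo[); rewrite big_ord0.
exists (fun=> 0); split=> [a | a b ab].
  by apply: is_iso_zero_spaces => // u; rewrite [u]thinmx0.
by rewrite comp_lfun0l comp_lfun0r.
Qed.

Definition scale_to (V : vectType K) (w : V) (c : K^o) : V := c *: w.

Lemma scale_to_is_linear (V : vectType K) (w : V) : linear (scale_to w).
Proof. by move=> k c d; rewrite /scale_to scalerDl scalerA. Qed.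

HB.instance Definition _ (V : vectType K) (w : V) :=
  GRing.isLinear.Build K K^o V _ (scale_to w) (@scale_to_is_linear V w).

(** Linear maps out of a space of [chi I]: when the point lies in [I], they are
    given by a vector; otherwise only the zero map exists. *)
Definition chi_elt (V : vectType K) (b : bool) (w : V) : 'Hom(chi_space K b, V) :=
  match b return 'Hom(chi_space K b, V) with
  | true => linfun (scale_to w)
  | false => 0
  end.

Lemma chi_elt_nat (V W : vectType K) (f : 'Hom(V, W)) (b b' : bool) v w :
  (b -> f v = if b' then w else 0) ->
  forall c, f (chi_elt b v c) = chi_elt b' w (chi_hom K b b' c).
Proof.
case: b => /= [/(_ isT) fv | _] c; last by rewrite !zero_lfunE !linear0.
rewrite lfunE /= /scale_to linearZ /= fv.
case: b' {fv} => /=; first by rewrite id_lfunE lfunE.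
by rewrite scaler0 !zero_lfunE.
Qed.

Definition copair (U V W : vectType K) (f : 'Hom(U, W)) (g : 'Hom(V, W))
  (x : (U * V)%type) : W := f x.1 + g x.2.

Lemma copair_is_linear (U V W : vectType K) (f : 'Hom(U, W)) (g : 'Hom(V, W)) :
  linear (copair f g).
Proof.
by move=> k x y; rewrite /copair /= !linearP scalerDr addrACA.
Qed.

HB.instance Definition _ (U V W : vectType K) (f : 'Hom(U, W)) (g : 'Hom(V, W)) :=
  GRing.isLinear.Build K (U * V)%type W _ (copair f g) (copair_is_linear f g).

(** When [b] holds, [p] is a linear form with [p w = 1] whose kernel is the
    image of [j], and the inverse sends [u] to [p u] and to the preimage of
    [u - p u *: w]; otherwise [j] is already an isomorphism. *)
Lemma copair_iso (V W : vectType K) (b : bool) (w : W) (p : 'Hom(W, K^o))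
    (j : 'Hom(V, W)) :
  (b -> p w = 1) -> injective j ->
  (forall u, (exists x, j x = u) <-> (b -> p u = 0)) ->
  is_iso (linfun (copair (chi_elt b w) j)).
Proof.
case: b => /= [/(_ isT) pw | _] j_inj j_im; apply/is_isoP; split.
- move=> [c x]; rewrite lfunE /= /copair /= lfunE /= /scale_to => cx0.
  have px : p (j x) = 0 by apply: (j_im (j x)).1 => //; exists x.
  have c0 : c = 0.
    by move/(congr1 p): cx0; rewrite linearD linearZ /= pw px linear0 addr0 [_ *: _]mulr1.
  move: cx0; rewrite c0 scale0r add0r -(linear0 j) => /j_inj ->.
  reflexivity.
- move=> u; have [|x jx] := (j_im (u - p u *: w)).2.
    by rewrite linearB linearZ /= pw [_ *: _]mulr1 subrr.
  by exists (p u, x); rewrite lfunE /= /copair /= lfunE /= /scale_to jx addrC subrK.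
- move=> [c x]; rewrite lfunE /= /copair /= zero_lfunE add0r [c]thinmx0.
  by rewrite -(linear0 j) => /j_inj ->.
- move=> u; have [//|x jx] := (j_im u).2.
  by exists (0, x); rewrite lfunE /= /copair /= zero_lfunE add0r jx.
Qed.

(** The vectors [v a] form a morphism from [chi I] to [D], and the conditions on
    [p] make it split at each point, with the image of [E] as kernel. As this
    image is stable under the maps of [D], the pointwise splittings are
    compatible with each other. *)
Lemma diagram_iso_split D E (I : interval R) (v : forall a, D a)
    (p : forall a, 'Hom(D a, K^o)) (j : forall a, 'Hom(E a, D a)) :
  (forall a b (ab : a <= b), a \in I ->
     dmap D ab (v a) = if b \in I then v b else 0) ->
  (forall a, a \in I -> p a (v a) = 1) ->
  (forall a, injective (j a)) ->
  (forall a b (ab : a <= b) x, j b (dmap E ab x) = dmap D ab (j a x)) ->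
  (forall a u, (exists x, j a x = u) <-> (a \in I -> p a u = 0)) ->
  diagram_iso D (dsum (chi K I) E).
Proof.
move=> v_nat pv j_inj j_nat j_im; apply: diagram_iso_sym.
exists (fun a => linfun (copair (chi_elt (a \in I) (v a)) (j a))).
split=> [a | a b ab]; first by apply: copair_iso => //; exact: pv.
apply/lfunP => -[c x].
rewrite !comp_lfunE dsum_mapE !lfunE /= /copair /= linearD j_nat.
by congr (_ + _); apply/esym/(chi_elt_nat (v_nat a b ab)).
Qed.

Section Subdiagram.
Variables (D : diagram K R) (U : forall a, {vspace D a}).
Hypothesis U_stable : forall a b (ab : a <= b) u, u \in U a -> dmap D ab u \in U b.

Definition subdiagram_map (a b : R) (ab : a <= b) :
    'Hom(subvs_of (U a), subvs_of (U b)) :=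
  (linfun (vsproj (U b)) \o dmap D ab \o linfun vsval)%VF.

Lemma subdiagram_mapE (a b : R) (ab : a <= b) (u : subvs_of (U a)) :
  vsval (subdiagram_map ab u) = dmap D ab (vsval u).
Proof.
rewrite !comp_lfunE !lfunE /= vsprojK //.
by apply: U_stable; exact: subvsP.
Qed.

Lemma subdiagram_map_id (a : R) (aa : a <= a) : subdiagram_map aa = \1%VF.
Proof.
by apply/lfunP => u; apply: subvs_inj; rewrite subdiagram_mapE id_lfunE dmap_idE.
Qed.

Lemma subdiagram_map_comp (a b c : R) (ab : a <= b) (bc : b <= c) (ac : a <= c) :
  subdiagram_map ac = (subdiagram_map bc \o subdiagram_map ab)%VF.
Proof.
apply/lfunP => u; apply: subvs_inj.
by rewrite [in RHS]comp_lfunE !subdiagram_mapE dmap_compE.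
Qed.

Definition subdiagram : diagram K R :=
  @Diagram K R (fun a => subvs_of (U a)) subdiagram_map
    subdiagram_map_id subdiagram_map_comp.

End Subdiagram.

Lemma exists_dual_functional (V : vectType K) (w : V) :
  w != 0 -> exists p : 'Hom(V, K^o), p w = 1.
Proof.
move=> w0; have [i wi] : exists i, coord (vbasis {:V}) i w != 0.
  apply/existsP; apply: contraNT w0 => /existsPn w_coord.
  rewrite (coord_vbasis (memvf w)) big1 // => i _.
  by have /negbNE/eqP -> := w_coord i; rewrite scale0r.
pose p (u : V) : K^o := coord (vbasis {:V}) i u / coord (vbasis {:V}) i w.
have p_lin : linear p.
  by move=> k u u'; rewrite /p linearP mulrDl -mulrA.
pose pL : {linear V -> K^o} :=
  HB.pack p (GRing.isLinear.Build _ _ _ _ _ p_lin).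
by exists (linfun pL); rewrite lfunE /= /p mulfV.
Qed.

End Splitting.

(** * Tame implies finite type *)

Section TameFiniteType.
Variables (K : fieldType) (R : realType).
Implicit Types D E : diagram K R.

(** The image of [v0] spans a bar over the points that [f] sends between [a] and
    [b], with complement the kernels of the forms induced by [p0]. This is a
    subdiagram of [D] over the whole line, not only over the image of [f]: its
    fibre at [x] is the kernel of [p0] composed with [D x -> D b], and all of
    [D x] when [b < x]. The result can therefore be split again. *)
Lemma split_off_bar D (f : R -> R) (f_mono : {homo f : x y / x <= y})
    (a b : R) (ab : a <= b) (v0 : D a) (p0 : 'Hom(D b, K^o)) :
  (forall x, f x < a -> forall u : D (f x), u = 0) ->
  (forall x (h : a <= f x), b < f x -> dmap D h v0 = 0) ->
  p0 (dmap D ab v0) = 1 ->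
  exists (I : interval R) (U : forall x, {vspace D x})
    (U_stable : forall x y (xy : x <= y) u, u \in U x -> dmap D xy u \in U y),
  v0 \notin U a /\
  diagram_iso (pullback D f_mono)
    (dsum (chi K I) (pullback (subdiagram U_stable) f_mono)).
Proof.
move=> D_below v0_above p0v0.
pose p x : 'Hom(D x, K^o) :=
  if pselect (x <= b) is left h then (p0 \o dmap D h)%VF else 0.
have pE x (h : x <= b) u : p x u = p0 (dmap D h u).
  rewrite /p; case: pselect => // h'.
  by rewrite comp_lfunE (bool_irrelevance h' h).
have p_above x : b < x -> p x = 0.
  by move=> bx; rewrite /p; case: pselect => // xb; rewrite ltNge xb in bx.
pose v x : D x := if pselect (a <= x) is left h then dmap D h v0 else 0.
have vE x (h : a <= x) : v x = dmap D h v0.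
  by rewrite /v; case: pselect => // h'; rewrite (bool_irrelevance h' h).
(* The preimage of [a, b] under the monotone f is convex, hence an interval,
   whatever its endpoints are. *)
pose I := Rhull [set x | a <= f x <= b].
have in_I x : (x \in I) = (a <= f x <= b).
  have : is_interval [set x | a <= f x <= b].
    move=> y z /= /andP[ay _] /andP[_ zb] w /andP[yw wz].
    by rewrite (le_trans ay) ?(le_trans _ zb) ?f_mono.
  move=> /is_intervalP IE.
  have {}IE : (a <= f x <= b : Prop) = (x \in I).
    exact: (congr1 (fun A : set R => A x) IE).
  by apply/idP/idP; rewrite IE.
have U_stable x y (xy : x <= y) u : u \in lker (p x) -> dmap D xy u \in lker (p y).
  rewrite !memv_ker; have [yb | /p_above ->] := leP y b; last by rewrite zero_lfunE.
  by rewrite (pE _ (le_trans xy yb)) (pE _ yb) (dmap_compE _ _ (le_trans xy yb)).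
have vsvalE x (w : subvs_of (lker (p x))) : linfun vsval w = vsval w.
  by rewrite lfunE.
exists I, (fun x => lker (p x)), U_stable; split.
  by rewrite memv_ker (pE _ ab) p0v0 oner_eq0.
apply: (@diagram_iso_split _ _ (pullback D f_mono)
  (pullback (subdiagram U_stable) f_mono) I (fun x => v (f x)) (fun x => p (f x))
  (fun x => linfun vsval)) => [x y xy|x|x u w|x y xy u|x u].
- rewrite !in_I => /andP[ax xb]; have ay := le_trans ax (f_mono _ _ xy).
  rewrite /= /pullback_map (vE _ ax) (dmap_compE _ _ ay) ay /=.
  by have [yb | yb] := leP (f y) b; [rewrite vE | rewrite v0_above].
- rewrite in_I => /andP[ax xb].
  by rewrite (pE _ xb) (vE _ ax) (dmap_compE _ _ ab).
- by rewrite !lfunE => /subvs_inj.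
- by rewrite !vsvalE; exact: (subdiagram_mapE U_stable).
split=> [[w <-] _ | pu0].
  by rewrite lfunE /=; apply/eqP; rewrite -memv_ker; exact: subvsP.
(* Outside I the kernel is everything: before a the space vanishes, and after b
   the form vanishes. *)
have u_ker : u \in lker (p (f x)).
  rewrite memv_ker; case: (boolP (x \in I)) => [/pu0/eqP // |].
  rewrite in_I negb_and -!ltNge => /orP[/D_below/(_ u) -> | /p_above ->].
    by rewrite linear0.
  by rewrite zero_lfunE.
by exists (vsproj _ u); rewrite lfunE /= vsprojK.
Qed.

Lemma lfun_neq0P (V W : vectType K) (g : 'Hom(V, W)) :
  g <> 0 -> exists v, g v != 0.
Proof.
move=> g0; apply: contrapT => no_v; apply: g0; apply/lfunP => v.
by rewrite zero_lfunE; apply/eqP; apply: contrapT => /negP gv; apply: no_v; exists v.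
Qed.

(** Induction on the total dimension at the samples. Minimality of [s ta] and
    maximality of [s tb] are what [split_off_bar] requires below and above the
    bar, and the dimension drops at [ta] because [v0] is not in the complement. *)
Lemma sampled_finite_type D (T : finType) (s : T -> R) (f : R -> R)
    (f_mono : {homo f : x y / x <= y}) :
  (forall x, exists t, f x = s t) -> finite_type (pullback D f_mono).
Proof.
move=> f_s; have [n] := ubnP (\sum_t \dim {: D (s t)})%N.
elim: n D => // n IHn D dimD.
pose nonzero t := \dim {: D (s t)} != 0%N.
case: (pickP nonzero) => [t0 t0_nz | all0]; last first.
  apply: finite_type_zero => x /=; case: (f_s x) => t -> u.
  have := memvf u; have /eqP := negbFE (all0 t).
  by move=> /eqP; rewrite dimv_eq0 => /eqP ->; rewrite memv0 => /eqP.
case: (@arg_minP _ _ _ t0 nonzero s t0_nz) => ta /= ta_nz ta_min.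
pose reached t := `[< exists h : s ta <= s t, dmap D h <> 0 >].
have ta_reached : reached ta.
  apply/asboolP; exists (lexx _); rewrite dmap_id => id0.
  case/negP: ta_nz; rewrite dimv_eq0; apply/eqP/vspaceP => u.
  by rewrite memvf memv0 -[u]id_lfunE id0 zero_lfunE eqxx.
case: (@arg_maxP _ _ _ ta reached s ta_reached).
move=> tb /asboolP[ab /lfun_neq0P[v0 v0b]] tb_max.
have [p0 p0v0] := exists_dual_functional v0b.
have [|x h bx|I [U [U_stable [v0U iso]]]] := split_off_bar f_mono _ _ p0v0.
- move=> x; case: (f_s x) => t -> t_a u.
  have := memvf u; case: (eqVneq (\dim {: D (s t)}) 0%N) => [/eqP|/ta_min].
    by rewrite dimv_eq0 => /eqP ->; rewrite memv0 => /eqP.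
  by move=> /(fun ta_t => le_lt_trans ta_t t_a); rewrite ltxx.
- move: h bx; case: (f_s x) => t -> h bx; apply: contrapT => hv0.
  have t_reached : reached t.
    by apply/asboolP; exists h => h0; apply: hv0; rewrite h0 zero_lfunE.
  by have := le_lt_trans (tb_max t t_reached) bx; rewrite ltxx.
apply: finite_type_iso iso _; apply: finite_type_dsum_chi; apply: IHn.
rewrite (leq_trans _ (dimD : _ <= n)%N) //.
have dim_sub t : \dim {: subdiagram U_stable (s t)} = \dim (U (s t)).
  by rewrite dimvf.
rewrite (bigD1 ta) //= [X in (_ < X)%N](bigD1 ta) //= -addSn leq_add //.
  rewrite dim_sub ltn_neqAle dimvS ?subvf // andbT.
  apply: contra v0U => /eqP dimE.
  have /eqP -> : U (s ta) == fullv by rewrite eqEdim subvf dimE leqnn.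
  exact: memvf.
by apply: leq_sum => t _; rewrite dim_sub dimvS ?subvf.
Qed.

Lemma tame_finite_type D : tame D -> finite_type D.
Proof.
move=> /tame_sampled[T [s [f [f_mono [f_s iso]]]]].
exact: finite_type_iso iso (sampled_finite_type D f_mono f_s).
Qed.

End TameFiniteType.

Theorem theorem4p6 (K : fieldType) (R : realType) (F : diagram K R) :
  tame F <-> finite_type F.
Proof. by split; [exact: tame_finite_type | exact: finite_type_tame]. Qed.
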